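(* Let $A,B\in\mathbb{R}_{\max}^{m\times n}$ have no common column identically equal to $-\infty$. Let $C=\begin{pmatrix}A\\ B\end{pmatrix}\in\mathbb{R}_{\max}^{2m\times n}$ and $D=\begin{pmatrix}I_m\\ I_m\end{pmatrix}\in\mathbb{R}_{\max}^{2m\times m}$, where $I_m$ is the max-plus identity matrix, and define maps $f,g,h:\mathbb{R}_{\max}^n\to\mathbb{R}_{\max}^n$ by $$f(x)=x\wedge A^{\sharp}Bx\wedge B^{\sharp}Ax,$$ $$g(x)=A^{\sharp}Ax\wedge B^{\sharp}Bx\wedge A^{\sharp}Bx\wedge B^{\sharp}Ax,$$ $$h(x)=A^{\sharp}Bx\wedge B^{\sharp}Ax.$$ Then $$r(P_CP_D)=r(P_DP_C)=r(f)=r(g)=r(h)=-\min_{x\in\mathbb{R}_{\max}^n,\ x\not\equiv-\infty} d_{\infty}(Ax,Bx).$$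
   Context: $\mathbb{R}_{\max}=\mathbb{R}\cup\{-\infty\}$ is the max-plus semiring (addition $\max$, multiplication $+$). For a matrix $A=(a_{ij})\in\mathbb{R}_{\max}^{m\times n}$ and $x\in\mathbb{R}_{\max}^n$, $Ax$ is the max-plus product $(Ax)_i=\max_j(a_{ij}+x_j)$. The residuated operator $A^{\sharp}$ acts on $y\in\mathbb{R}_{\max}^m$ by $(A^{\sharp}y)_j=\min_{1\le i\le m}(-a_{ij}+y_i)$ with the convention $(-\infty)+(+\infty)=+\infty$ (so only indices with $a_{ij}\ne-\infty$ matter, and the value is $+\infty$ if column $j$ of $A$ is identically $-\infty$). Juxtaposition such as $A^{\sharp}Bx$ means composition of operators, $A^{\sharp}(Bx)$. $\wedge$ denotes componentwise minimum. The max-plus identity $I_m$ has diagonal entries $0$ and off-diagonal entries $-\infty$. For a matrix $M$ over $\mathbb{R}_{\max}$, $P_M$ is the nonlinear projector onto the max-plus column span of $M$: $P_M z=MM^{\sharp}z$ (the greatest element $y\le z$ of the max-plus span of the columns of $M$). For an order-preserving, additively homogeneous ($f(\lambda+x)=\lambda+f(x)$) map $f:\mathbb{R}_{\max}^N\to\mathbb{R}_{\max}^N$ continuous in the topology of the metric $\max_i|e^{x_i}-e^{y_i}|$, the spectral radius is $r(f)=\max\{\lambda\in\mathbb{R}_{\max}\mid \exists x\in\mathbb{R}_{\max}^N,\ x\not\equiv-\infty,\ \lambda+x=f(x)\}$. For $u,v\in\mathbb{R}_{\max}^m$ let $\mathrm{supp}(u)=\{i: u_i\neq-\infty\}$; the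 Chebyshev distance is $d_\infty(u,v)=\max_{i\in\mathrm{supp}(v)}|u_i-v_i|$ if $\mathrm{supp}(u)=\mathrm{supp}(v)$, and $+\infty$ otherwise. *)

(* Defs.v *)
From HB Require Import structures.
From mathcomp Require Import all_boot all_order all_algebra.
From mathcomp Require Import boolp classical_sets reals constructive_ereal.

Set Implicit Arguments.
Unset Strict Implicit.
Unset Printing Implicit Defensive.

Import Order.TTheory GRing.Theory Num.Theory.

Local Open Scope ring_scope.
Local Open Scope ereal_scope.

Section MaxPlus.
Context {R : realType}.

(* The max-plus semiring is represented inside \bar R, as the elements other
   than +oo: residuation may produce +oo, so operators are defined on vectors
   over the whole of \bar R and membership in R_max is a predicate. *)
Definition in_Rmax m n (M : 'M[\bar R]_(m, n)) : Prop :=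
  forall i j, M i j != +oo.

Definition mp_mul m n p (A : 'M[\bar R]_(m, n)) (B : 'M[\bar R]_(n, p)) :
    'M[\bar R]_(m, p) :=
  \matrix_(i, k) \big[maxe/-oo]_j (A i j + B j k).

Definition mp_id m : 'M[\bar R]_m :=
  \matrix_(i, j) (if i == j then 0 else -oo).

(* The dual addition %dE is the one with (-oo) + (+oo) = +oo. *)
Definition residual m n (A : 'M[\bar R]_(m, n)) (y : 'cV[\bar R]_m) :
    'cV[\bar R]_n :=
  \col_j \big[mine/+oo]_i (- A i j + y i ord0)%dE.

Definition projector m n (M : 'M[\bar R]_(m, n)) (z : 'cV[\bar R]_m) :
    'cV[\bar R]_m :=
  mp_mul M (residual M z).

Definition vmin n (x y : 'cV[\bar R]_n) : 'cV[\bar R]_n := map2_mx mine x y.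

Definition mp_scale n (lam : \bar R) (x : 'cV[\bar R]_n) : 'cV[\bar R]_n :=
  map_mx (fun t => lam + t) x.

Definition mp_zero n : 'cV[\bar R]_n := const_mx -oo.

Definition is_max (S : set (\bar R)) (v : \bar R) : Prop := S v /\ ubound S v.
Definition is_min (S : set (\bar R)) (v : \bar R) : Prop := S v /\ lbound S v.

Definition mp_eigenvalue n (f : 'cV[\bar R]_n -> 'cV[\bar R]_n) :
    set (\bar R) :=
  fun lam => lam != +oo /\
    exists x, [/\ in_Rmax x, x != mp_zero n & mp_scale lam x = f x].

Definition is_spectral_radius n (f : 'cV[\bar R]_n -> 'cV[\bar R]_n)
  (r : \bar R) : Prop := is_max (mp_eigenvalue f) r.

Definition supp m (u : 'cV[\bar R]_m) : {set 'I_m} :=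
  finset (fun i => u i ord0 != -oo).

(* The entries compared are finite; the distance is 0 when both supports are
   empty. *)
Definition chebyshev_dist m (u v : 'cV[\bar R]_m) : \bar R :=
  if supp u == supp v
  then \big[maxe/0]_(i in supp v) `|u i ord0 - v i ord0|
  else +oo.

End MaxPlus.

(* Main.v *)
Require Import Defs.
From mathcomp Require Import all_boot all_order all_algebra.
From mathcomp Require Import boolp classical_sets filter reals constructive_ereal.
From mathcomp Require Import ereal lra.

(* Call a real lam a subeigenvalue of F when lam + x <= F x for some nonzero x
   in R_max^n.  A monotone, additively homogeneous, continuous F has a spectral
   radius, and it dominates every subeigenvalue: when F x dominates
   eps + max x, iterating F - lam on a subeigenvector for the greatest
   subeigenvalue lam gives a bounded increasing orbit, whose limit is an
   eigenvector; in general one applies this to max(F x, - k + max x) and takes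
   the limit of the normalised eigenvectors.  The spectral radius is therefore
   determined by the set of subeigenvalues, and residuation shows that the five
   maps have the same ones: lam + x <= h x means lam + A x <= B x and
   lam + B x <= A x, i.e. d(Ax, Bx) <= - lam (which forces lam <= 0), whereas
   g = C^# P_D C, P_C P_D = C (C^# P_D) and P_D P_C = (P_D C) C^# compose the
   same factors in cyclically permuted order.
   Compactness and continuity are expressed by limits along a free ultrafilter
   on nat. *)

Set Implicit Arguments.
Unset Strict Implicit.
Unset Printing Implicit Defensive.

Import Order.TTheory GRing.Theory Num.Theory DualAddTheory.

Local Open Scope ring_scope.
Local Open Scope ereal_scope.

(** * Limits along an ultrafilter *)

Section Ultralimit.
Context {R : realType} (U : set_system nat) {UU : UltraFilter U}.
Implicit Types (a b : nat -> \bar R) (c : \bar R).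

(** The supremum of the constants below [a] on a set of [U]; order completeness gives every sequence
    a limit, with no convergence to prove. *)
Definition ulim a : \bar R := ereal_sup [set c | U [set k | c <= a k]]%classic.

Lemma ulim_ge a c : U [set k | c <= a k]%classic -> c <= ulim a.
Proof. by move=> h; apply: ereal_sup_ubound. Qed.

Lemma ulim_le a c : U [set k | a k <= c]%classic -> ulim a <= c.
Proof.
move=> h; apply: ge_ereal_sup => d /= hd.
have [k [/= h1 h2]] := filter_ex (filterI h hd).
exact: le_trans h2 h1.
Qed.

Lemma ulim_homo a b : U [set k | a k <= b k]%classic -> ulim a <= ulim b.
Proof.
move=> h; apply: ge_ereal_sup => d /= hd; apply: ulim_ge.
by apply: filterS (filterI h hd) => k /= [h1 h2]; exact: le_trans h2 h1.
Qed.

Lemma ulim_cst c : ulim (fun=> c) = c.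
Proof.
apply/eqP; rewrite eq_le; apply/andP; split.
  by apply: ulim_le; apply: filterE => k /=.
by apply: ulim_ge; apply: filterE => k /=.
Qed.

Lemma ulim_shift (r : R) a : ulim (fun k => r%:E + a k) = r%:E + ulim a.
Proof.
apply/eqP; rewrite eq_le; apply/andP; split.
  apply: ge_ereal_sup => c /= hc; rewrite -leeBlDl//; apply: ulim_ge.
  by apply: filterS hc => k; rewrite /mkset leeBlDl.
rewrite -leeBrDl//; apply: ge_ereal_sup => c hc; rewrite leeBrDl//.
by apply: ulim_ge; apply: filterS hc => k /= hk; exact: leeD2l.
Qed.

(** If [c] is below the maximum on a set of [U], then [c <= a k] holds on a set of [U] or fails on
    one, and there [c <= b k]: maximality of the filter is what is used. *)
Lemma ulim_max a b : ulim (fun k => maxe (a k) (b k)) = maxe (ulim a) (ulim b).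
Proof.
apply/eqP; rewrite eq_le; apply/andP; split; last first.
  rewrite ge_max; apply/andP; split; apply: ulim_homo; apply: filterE => k /=;
    by rewrite le_max lexx ?orbT.
apply: ge_ereal_sup => c /= hc; rewrite le_max.
have [h|h] := in_ultra_setVsetC [set k | c <= a k]%classic UU.
  by rewrite ulim_ge.
rewrite orbC ulim_ge//; apply: filterS (filterI h hc) => k /= [h1].
by rewrite le_max => /orP[].
Qed.

Lemma ulim_min a b : ulim (fun k => mine (a k) (b k)) = mine (ulim a) (ulim b).
Proof.
apply/eqP; rewrite eq_le; apply/andP; split.
  rewrite le_min; apply/andP; split; apply: ulim_homo; apply: filterE => k /=;
    by rewrite ge_min lexx ?orbT.
rewrite ge_min.
have [h|h] := in_ultra_setVsetC [set k | a k <= b k]%classic UU.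
  by rewrite ulim_homo//; apply: filterS h => k /= h; rewrite min_l.
rewrite orbC ulim_homo//; apply: filterS h => k /=.
by move=> /negP; rewrite -ltNge => /ltW h; rewrite min_r.
Qed.

End Ultralimit.

(** * Monotone, homogeneous, continuous maps *)

Section RegularMaps.
Context {R : realType} (U : set_system nat) {UU : UltraFilter U}.

Definition vle n (x y : 'cV[\bar R]_n) := forall i, x i ord0 <= y i ord0.

Definition vlim n (u : nat -> 'cV[\bar R]_n) : 'cV[\bar R]_n :=
  \col_i ulim U (fun k => u k i ord0).

(** Monotonicity, homogeneity and continuity, the last as commutation with ultralimits. These
    survive finite maxima, minima and real shifts, from which all the operators are built. They are
    stated over all of [\bar R]; staying inside R_max is a separate condition. *)
Record regular_fun n (phi : 'cV[\bar R]_n -> \bar R) : Prop := {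
  rf_homo : forall x y, vle x y -> phi x <= phi y;
  rf_scale : forall (r : R) x, phi (mp_scale r%:E x) = r%:E + phi x;
  rf_lim : forall u, phi (vlim u) = ulim U (fun k => phi (u k)) }.

Definition regular_map n p (F : 'cV[\bar R]_n -> 'cV[\bar R]_p) : Prop :=
  forall i, regular_fun (fun x => F x i ord0).

Lemma regular_coord n (i : 'I_n) : regular_fun (fun x => x i ord0).
Proof.
split=> [x y h|r x|u]; [exact: h|by rewrite mxE|by rewrite mxE].
Qed.

Lemma regular_Ny n : regular_fun (fun x : 'cV[\bar R]_n => -oo).
Proof. by split=> [//|//|u]; rewrite ulim_cst. Qed.

Lemma regular_y n : regular_fun (fun x : 'cV[\bar R]_n => +oo).
Proof. by split=> [//|//|u]; rewrite ulim_cst. Qed.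

Lemma regular_shift n (phi : 'cV[\bar R]_n -> \bar R) (r : R) :
  regular_fun phi -> regular_fun (fun x => r%:E + phi x).
Proof.
move=> [h1 h2 h3]; split=> [x y xy|s x|u].
- by apply: leeD2l; apply: h1.
- by rewrite h2 addeCA.
- by rewrite h3 ulim_shift.
Qed.

Lemma regular_max n (phi psi : 'cV[\bar R]_n -> \bar R) :
  regular_fun phi -> regular_fun psi ->
  regular_fun (fun x => maxe (phi x) (psi x)).
Proof.
move=> [h1 h2 h3] [k1 k2 k3]; split=> [x y xy|s x|u].
- by rewrite ge_max !le_max h1 ?k1 ?orbT.
- by rewrite h2 k2 adde_maxr.
- by rewrite h3 k3 ulim_max.
Qed.

Lemma regular_min n (phi psi : 'cV[\bar R]_n -> \bar R) :
  regular_fun phi -> regular_fun psi ->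
  regular_fun (fun x => mine (phi x) (psi x)).
Proof.
move=> [h1 h2 h3] [k1 k2 k3]; split=> [x y xy|s x|u].
- by rewrite le_min !ge_min h1 ?k1 ?orbT.
- rewrite h2 k2; have [h|h] := leP (phi x) (psi x).
    by rewrite min_l// leeD2l.
  by rewrite min_r// leeD2l// ltW.
- by rewrite h3 k3 ulim_min.
Qed.

Lemma regular_bigmax n p (phi : 'I_p -> 'cV[\bar R]_n -> \bar R) :
  (forall j, regular_fun (phi j)) ->
  regular_fun (fun x => \big[maxe/-oo]_j phi j x).
Proof.
move=> h; elim: (index_enum _) => [|j s IH].
  by under eq_fun do rewrite big_nil; exact: regular_Ny.
by under eq_fun do rewrite big_cons; exact: regular_max.
Qed.

Lemma regular_bigmin n p (phi : 'I_p -> 'cV[\bar R]_n -> \bar R) :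
  (forall j, regular_fun (phi j)) ->
  regular_fun (fun x => \big[mine/+oo]_j phi j x).
Proof.
move=> h; elim: (index_enum _) => [|j s IH].
  by under eq_fun do rewrite big_nil; exact: regular_y.
by under eq_fun do rewrite big_cons; exact: regular_min.
Qed.

Lemma regular_id n : regular_map (fun x : 'cV[\bar R]_n => x).
Proof. by move=> i; exact: regular_coord. Qed.

Section RegularMapTheory.
Context {n p : nat} (F : 'cV[\bar R]_n -> 'cV[\bar R]_p) (hF : regular_map F).

Lemma regular_map_homo x y : vle x y -> vle (F x) (F y).
Proof. by move=> h i; exact: (rf_homo (hF i)). Qed.

Lemma regular_map_scale (r : R) x :
  F (mp_scale r%:E x) = mp_scale r%:E (F x).
Proof. by apply/colP => i; rewrite (rf_scale (hF i)) mxE. Qed.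

Lemma regular_map_lim u : F (vlim u) = vlim (fun k => F (u k)).
Proof. by apply/colP => i; rewrite (rf_lim (hF i)) mxE. Qed.

End RegularMapTheory.

Lemma regular_comp n p q (F : 'cV[\bar R]_n -> 'cV[\bar R]_p)
    (G : 'cV[\bar R]_p -> 'cV[\bar R]_q) :
  regular_map F -> regular_map G -> regular_map (fun x => G (F x)).
Proof.
move=> hF hG i; split=> [x y xy|r x|u].
- exact: (regular_map_homo hG (regular_map_homo hF xy)).
- by rewrite !regular_map_scale// mxE.
- by rewrite !regular_map_lim// mxE.
Qed.

Lemma regular_vmin n p (F G : 'cV[\bar R]_n -> 'cV[\bar R]_p) :
  regular_map F -> regular_map G -> regular_map (fun x => vmin (F x) (G x)).
Proof.
move=> hF hG i; under eq_fun do rewrite mxE.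
exact: regular_min (hF i) (hG i).
Qed.

Lemma regular_mul m n (A : 'M[\bar R]_(m, n)) :
  in_Rmax A -> regular_map (fun x => mp_mul A x).
Proof.
move=> hA i; under eq_fun do rewrite mxE; apply: regular_bigmax => j.
case: (A i j) (hA i j) => [r||]// _; first exact/regular_shift/regular_coord.
exact: regular_Ny.
Qed.

Lemma regular_residual m n (A : 'M[\bar R]_(m, n)) :
  in_Rmax A -> regular_map (residual A).
Proof.
move=> hA j; under eq_fun do rewrite mxE; apply: regular_bigmin => i.
case: (A i j) (hA i j) => [r||]// _.
  under eq_fun do rewrite dual_addeE_def ?fin_num_adde_defr//.
  exact/regular_shift/regular_coord.
(* A -oo entry of [A] becomes +oo, which absorbs everything in the dual sum. *)
under eq_fun do rewrite daddeC daddey.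
exact: regular_y.
Qed.

Lemma regular_projector m n (M : 'M[\bar R]_(m, n)) :
  in_Rmax M -> regular_map (projector M).
Proof.
by move=> hM; apply: regular_comp; [exact: regular_residual|exact: regular_mul].
Qed.

End RegularMaps.

(** * Max-plus vectors: order, translations, greatest entry *)

Lemma maxe_neqy {R : realType} (a b : \bar R) :
  a != +oo -> b != +oo -> maxe a b != +oo.
Proof. by rewrite /maxe; case: ifP. Qed.

Lemma bigmaxe_neqy {R : realType} {p : nat} (phi : 'I_p -> \bar R) :
  (forall i, phi i != +oo) -> \big[maxe/-oo]_i phi i != +oo.
Proof. by move=> h; elim/big_ind: _ => // a b; exact: maxe_neqy. Qed.

Section VectorOrder.
Context {R : realType} {n : nat}.
Implicit Types x y z : 'cV[\bar R]_n.

Lemma vle_refl x : vle x x. Proof. by move=> i. Qed.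

Lemma vle_trans y x z : vle x y -> vle y z -> vle x z.
Proof. by move=> h k i; exact: le_trans (h i) (k i). Qed.

Lemma vle_anti x y : vle x y -> vle y x -> x = y.
Proof. by move=> h k; apply/colP => i; apply: le_anti; rewrite h k. Qed.

Lemma vle_scale (c : \bar R) x y : vle x y -> vle (mp_scale c x) (mp_scale c y).
Proof. by move=> h i; rewrite !mxE leeD2l. Qed.

Lemma mp_scaleA (r s : R) x :
  mp_scale r%:E (mp_scale s%:E x) = mp_scale (r + s)%:E x.
Proof. by apply/colP => i; rewrite !mxE addeA. Qed.

Lemma mp_scale0 x : mp_scale 0 x = x.
Proof. by apply/colP => i; rewrite !mxE add0e. Qed.

Lemma mp_scaleK (r : R) x : mp_scale (- r)%:E (mp_scale r%:E x) = x.
Proof. by rewrite mp_scaleA addNr mp_scale0. Qed.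

Lemma mp_scaleNK (r : R) x : mp_scale r%:E (mp_scale (- r)%:E x) = x.
Proof. by rewrite mp_scaleA subrr mp_scale0. Qed.

Lemma Rmax_scale (r : R) x : in_Rmax x -> in_Rmax (mp_scale r%:E x).
Proof. by move=> h i j; rewrite mxE; case: (x i j) (h i j). Qed.

Lemma Rmax_vle x y : vle x y -> in_Rmax y -> in_Rmax x.
Proof.
by move=> xy hy i j; rewrite !ord1 -ltey (le_lt_trans (xy i))// ltey hy.
Qed.

Lemma neq_zero_vle x y : vle x y -> x != mp_zero n -> y != mp_zero n.
Proof.
move=> xy; apply: contraNneq => y0; apply/eqP/colP => i.
by apply/eqP; rewrite mxE -leeNy_eq; have := xy i; rewrite y0 mxE.
Qed.

Lemma scale_neq_zero (r : R) x : x != mp_zero n -> mp_scale r%:E x != mp_zero n.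
Proof.
apply: contra_neq => rx0; rewrite -(mp_scaleK r x) rx0.
by apply/colP => i; rewrite !mxE addeNy.
Qed.

(** Serves to normalise vectors: [vtop x = 0] encodes both membership in R_max and nonvanishing, and
    it passes to ultralimits. *)
Definition vtop x : \bar R := \big[maxe/-oo]_i x i ord0.

Lemma le_vtop x i : x i ord0 <= vtop x.
Proof. exact: (@le_bigmax _ (\bar R)). Qed.

Lemma vtop_le x c : (forall i, x i ord0 <= c) -> vtop x <= c.
Proof. by move=> h; rewrite /vtop; apply: bigmax_le => //; rewrite leNye. Qed.

Lemma vtop_fin x : in_Rmax x -> x != mp_zero n -> vtop x \is a fin_num.
Proof.
move=> hx x0; rewrite fin_numE; apply/andP; split.
  apply: contra x0 => /eqP x0; apply/eqP/colP => i; apply/eqP.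
  by rewrite mxE -leeNy_eq -x0 le_vtop.
by apply: bigmaxe_neqy.
Qed.

Lemma vtop0_Rmax x : vtop x = 0 -> in_Rmax x.
Proof.
by move=> x0 i j; rewrite ord1 -ltey (le_lt_trans (le_vtop x i))// x0 ltry.
Qed.

Lemma vtop0_neq_zero x : vtop x = 0 -> x != mp_zero n.
Proof.
move=> x0; apply/eqP => xz; have : vtop x <= -oo.
  by apply: vtop_le => i; rewrite xz mxE.
by rewrite x0.
Qed.

Lemma regular_vtop (U : set_system nat) {UU : UltraFilter U} :
  regular_fun U vtop.
Proof. by apply: regular_bigmax => i; exact: regular_coord. Qed.

End VectorOrder.

(** * Existence of the spectral radius *)

Section SubEigenvalues.
Context {R : realType} (U : set_system nat) {UU : UltraFilter U}.
Context (U_infty : forall N, U [set k | (N <= k)%N]%classic).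
Context {n : nat}.
Implicit Types (F : 'cV[\bar R]_n -> 'cV[\bar R]_n) (x : 'cV[\bar R]_n).

Lemma ulim_oppr_nat : ulim U (fun k => (- k%:R : R)%:E) = -oo.
Proof.
apply: oppe_inj; apply/eqyP => r /ltW r0; rewrite leeNr; apply: ulim_le.
apply: filterS (U_infty (Num.bound r)) => k /= le_k; rewrite lee_fin lerN2.
by rewrite (le_trans (ltW (archi_boundP r0)))// ler_nat.
Qed.

(** Only real values are considered: -oo would qualify trivially, and a spectral radius -oo
    corresponds to the absence of real subeigenvalues. *)
Definition subeigenvalue F (lam : R) : Prop :=
  exists x, [/\ in_Rmax x, x != mp_zero n & vle (mp_scale lam%:E x) (F x)].

Definition Rmax_stable F := forall x, in_Rmax x -> in_Rmax (F x).

Lemma vtop_scale (r : R) x : vtop (mp_scale r%:E x) = r%:E + vtop x.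
Proof. exact: (rf_scale (regular_vtop (U := U))). Qed.

Lemma normalize x : in_Rmax x -> x != mp_zero n ->
  exists r : R, vtop (mp_scale r%:E x) = 0.
Proof.
move=> hx x0; exists (- fine (vtop x))%R.
by rewrite vtop_scale EFinN fineK ?vtop_fin// addeC subee// vtop_fin.
Qed.

Lemma subeigenvalueP F lam : regular_map U F ->
  subeigenvalue F lam ->
  exists x, vtop x = 0 /\ vle (mp_scale lam%:E x) (F x).
Proof.
move=> hF [x [hx x0 le_x]]; have [r rx] := normalize hx x0.
exists (mp_scale r%:E x); split=> //; rewrite (regular_map_scale hF).
by rewrite mp_scaleA addrC -mp_scaleA; exact: vle_scale.
Qed.

Lemma regular_scale r F :
  regular_map U F -> regular_map U (fun x => mp_scale r%:E (F x)).
Proof.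
by move=> hF i; under eq_fun do rewrite mxE; exact: regular_shift (hF i).
Qed.

Lemma Rmax_stable_scale r F :
  Rmax_stable F -> Rmax_stable (fun x => mp_scale r%:E (F x)).
Proof. by move=> hF x hx; apply/Rmax_scale/hF. Qed.

Lemma subeigenvalue_scale r F lam :
  subeigenvalue (fun x => mp_scale r%:E (F x)) lam ->
  subeigenvalue F (lam - r)%R.
Proof.
move=> [x [hx x0 le_x]]; exists x; split=> //.
rewrite -[F x](mp_scaleK r) addrC -mp_scaleA; exact: vle_scale.
Qed.

(** A normalised subeigenvector lies below the constant vector 0, so [lam] is at most the greatest
    entry of the image of that vector. *)
Lemma subeigenvalue_bounded F : regular_map U F -> Rmax_stable F ->
  exists M : R, forall lam, subeigenvalue F lam -> (lam <= M)%R.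
Proof.
move=> hF sF; exists (fine (vtop (F (const_mx 0)))) => lam.
move=> /(subeigenvalueP hF)[x [x0 le_x]].
have hvtop := rf_homo (regular_vtop (U := U)).
have le_lam : lam%:E <= vtop (F (const_mx 0)).
  have -> : lam%:E = vtop (mp_scale lam%:E x) by rewrite vtop_scale x0 adde0.
  apply: hvtop.
  apply: vle_trans le_x _; apply: regular_map_homo hF _ _ _ => i.
  by rewrite mxE -x0 le_vtop.
rewrite -lee_fin fineK// fin_numE; apply/andP; split.
  by rewrite -ltNye (lt_le_trans _ le_lam)// ltNyr.
by apply: bigmaxe_neqy => i; apply: sF => j k; rewrite mxE.
Qed.

(** The supremum is attained: normalised subeigenvectors for values within [1/(k+1)] of it have an
    ultralimit that is a normalised subeigenvector for the supremum itself. *)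
Lemma subeigenvalue_max F : regular_map U F -> Rmax_stable F ->
  (exists lam, subeigenvalue F lam) ->
  exists s, subeigenvalue F s /\
    forall lam, subeigenvalue F lam -> (lam <= s)%R.
Proof.
move=> hF sF [lam0 hlam0]; pose S := [set lam | subeigenvalue F lam]%classic.
have [M hM] := subeigenvalue_bounded hF sF.
have supS : has_sup S by split; [exists lam0|exists M => lam /hM].
have le_supS lam : S lam -> (lam <= sup S)%R.
  by move=> h; exact: (ub_le_sup (proj2 supS)).
exists (sup S); split; last by move=> lam /le_supS.
have /choice[u hu] (k : nat) : exists x, vtop x = 0 /\
    vle (mp_scale (sup S - k.+1%:R^-1)%:E x) (F x).
  have [//|lam hlam lt_lam] := sup_adherent (eps := k.+1%:R^-1) _ supS.
  have [x [x0 le_x]] := subeigenvalueP hF hlam.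
  exists x; split=> //; apply: vle_trans le_x => i.
  by rewrite !mxE leeD2r// lee_fin ltW.
have x0 : vtop (vlim U u) = 0.
  rewrite (rf_lim (regular_vtop (U := U))).
  by under eq_fun do rewrite (hu _).1; rewrite ulim_cst.
exists (vlim U u); split; [exact: vtop0_Rmax|exact: vtop0_neq_zero|].
move=> i; rewrite mxE; apply/lee_subgt0Pr => e e0.
rewrite addeAC -EFinB (rf_lim (hF i)) mxE -ulim_shift; apply: ulim_homo.
have [N hN] := ltr_add_invr (y := 0) e0; rewrite add0r in hN.
apply: filterS (U_infty N) => k /= Nk.
apply: le_trans ((hu k).2 i); rewrite mxE leeD2r// lee_fin lerD2l lerN2.
by rewrite (le_trans _ (ltW hN))// lef_pV2 ?posrE// ler_nat.
Qed.

(* The maximum of x, F x, ..., F^J x is a subeigenvector. *)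
Lemma subeigenvalue_iter F x J : regular_map U F -> Rmax_stable F ->
  in_Rmax x -> x != mp_zero n -> vle x (iter J.+1 F x) -> subeigenvalue F 0.
Proof.
move=> hF sF hx x0 le_x.
have hit k : in_Rmax (iter k F x) by elim: k => //= k; exact: sF.
pose z : 'cV[\bar R]_n :=
  \col_i \big[maxe/-oo]_(k < J.+1) iter k F x i ord0.
have le_z k : (k <= J)%N -> vle (iter k F x) z.
  by rewrite -ltnS => kJ i; rewrite mxE; exact: (@le_bigmax _ (\bar R) _ _ _ (Ordinal kJ)).
exists z; split.
- move=> i j; rewrite mxE; apply: bigmaxe_neqy => k; exact: hit.
- exact: neq_zero_vle (le_z 0%N (leq0n J)) x0.
- rewrite mp_scale0 => i; rewrite mxE; apply: bigmax_le; first by rewrite leNye.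
  move=> [[|k] kJ] _ /=.
    apply: le_trans (le_x i) _; exact: (regular_map_homo hF (le_z J _)).
  by apply: (regular_map_homo hF (le_z k _)); exact: ltnW.
Qed.

Lemma iter_scale F r x k : regular_map U F ->
  iter k (fun y => mp_scale r%:E (F y)) x = mp_scale (r *+ k)%:E (iter k F x).
Proof.
move=> hF; elim: k => [|k IH]; first by rewrite mulr0n mp_scale0.
by rewrite !iterS IH (regular_map_scale hF) mp_scaleA mulrS.
Qed.

(* The maximal subeigenvector generates an increasing orbit; the lower bound
   on F makes this orbit bounded, as otherwise some iterate would dominate a
   translate of the subeigenvector, contradicting maximality. *)
Lemma eigenvector_of_bounded_below F (eps : R) :
  (0 < n)%N -> regular_map U F -> Rmax_stable F ->
  (forall x i, eps%:E + vtop x <= F x i ord0) ->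
  exists s y, [/\ vtop y = 0, F y = mp_scale s%:E y &
    forall lam, subeigenvalue F lam -> (lam <= s)%R].
Proof.
move=> n0 hF sF hlow.
have [|s [hs s_max]] := subeigenvalue_max hF sF.
  (* By the lower bound on [F], the constant vector 0 is a subeigenvector for [eps]. *)
  exists eps, (const_mx 0); split.
  - by move=> i j; rewrite mxE.
  - apply/eqP => /colP /(_ (Ordinal n0)); by rewrite !mxE.
  - move=> i; apply: le_trans (hlow _ i); rewrite mxE leeD2l//.
    exact: le_vtop.
have [x [x0 le_x]] := subeigenvalueP hF hs.
pose G y := mp_scale (- s)%:E (F y).
have hG : regular_map U G by exact: regular_scale.
have sG : Rmax_stable G by exact: Rmax_stable_scale.
have xG : vle x (G x).
  by rewrite -[x in vle x _](mp_scaleK s); exact: vle_scale.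
pose u k := iter k G x.
have Ru k : in_Rmax (u k).
  by elim: k => [|k /sG//]; exact: vtop0_Rmax.
have uS k : vle (u k) (u k.+1).
  by elim: k => [//|k IH]; exact: regular_map_homo hG _ _ IH.
have u_homo k l : (k <= l)%N -> vle (u k) (u l).
  move=> /subnK <-; elim: (l - k)%N => [|d IH]; first exact: vle_refl.
  exact: vle_trans IH (uS _).
have u_neq0 k : u k != mp_zero n.
  by apply: neq_zero_vle (u_homo 0%N k (leq0n k)) _; exact: vtop0_neq_zero.
have u_bounded k : vtop (u k) <= (s - eps)%:E.
  rewrite leNgt; apply/negP => hk.
  have ft := vtop_fin (Ru k) (u_neq0 k).
  move: hk; rewrite -(fineK ft) lte_fin; set t := fine _ => hk.
  (* Every entry of [u k.+1], which is [- s + F (u k)], is at least [- s + eps + t = d], whereas the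
     entries of [x] are at most 0. *)
  pose d := (t - (s - eps))%R; have d0 : (0 < d)%R by rewrite subr_gt0.
  have le_d : vle (mp_scale d%:E x) (u k.+1).
    move=> i; rewrite [u k.+1]/= !mxE; apply: (@le_trans _ _ d%:E).
      rewrite -[leRHS]adde0 leeD2l// -x0; exact: le_vtop.
    apply: le_trans (leeD2l _ (hlow (u k) i)).
    rewrite -(fineK ft) -/t -!EFinD lee_fin.
    by rewrite [d](_ : _ = - s + (eps + t))%R // /d opprB addrC -addrA addrCA.
  (* The gain [d] is spread evenly over the [k+1] iterations; it makes [s + d/(k+1)] a subeigenvalue
     of [F], above the maximum [s]. *)
  have : subeigenvalue (fun y => mp_scale (- (d / k.+1%:R))%:E (G y)) 0.
    apply: (@subeigenvalue_iter _ x k).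
    - exact: regular_scale.
    - exact: Rmax_stable_scale.
    - exact: (Ru 0%N).
    - exact: (u_neq0 0%N).
    rewrite (iter_scale _ _ _ hG) mulNrn -[(d / _ *+ _)%R]mulr_natr divfK ?pnatr_eq0//.
    by rewrite -[x in vle x _](mp_scaleK d); exact: vle_scale.
  move=> /subeigenvalue_scale /subeigenvalue_scale /s_max.
  by rewrite add0r !opprK gerDr leNgt divr_gt0.
pose y := vlim U u.
have le_y k : vle (u k) y.
  move=> i; rewrite mxE; apply: ulim_ge; apply: filterS (U_infty k) => l /= kl.
  exact: u_homo.
(* An ultralimit need not be invariant under a shift of the index; since the orbit increases,
   [u k.+1 <= y] and [u k <= u k.+1] give the two inequalities. *)
have Gy : G y = y.
  rewrite (regular_map_lim hG); apply: vle_anti => i.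
    by rewrite mxE; apply: ulim_le; apply: filterE => k; exact: (le_y k.+1).
  by rewrite !mxE; apply: ulim_homo; apply: filterE => k; exact: uS.
have Fy : F y = mp_scale s%:E y by rewrite -{2}Gy mp_scaleNK.
have Ry : in_Rmax y.
  move=> i j; rewrite ord1 -ltey mxE.
  apply: (@le_lt_trans _ _ (s - eps)%:E); last by rewrite ltry.
  by apply: ulim_le; apply: filterE => k; exact: le_trans (le_vtop _ i) _.
have y_neq0 : y != mp_zero n := neq_zero_vle (le_y 0%N) (u_neq0 0%N).
have [r ry] := normalize Ry y_neq0.
exists s, (mp_scale r%:E y); split=> //.
by rewrite (regular_map_scale hF) Fy !mp_scaleA addrC.
Qed.

(** The perturbations [P k] are bounded below and have eigenvalues [s k], which decrease with [k]
    and dominate the subeigenvalues of [F]. Their infimum, possibly -oo, is an eigenvalue of [F]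
    whose eigenvector is the ultralimit of the normalised eigenvectors. *)
Lemma spectral_radius_exists F :
  (0 < n)%N -> regular_map U F -> Rmax_stable F ->
  exists2 r, is_spectral_radius F r &
    forall lam, subeigenvalue F lam -> lam%:E <= r.
Proof.
move=> n0 hF sF.
pose P (k : nat) x : 'cV[\bar R]_n :=
  \col_i maxe (F x i ord0) ((- k%:R)%:E + vtop x).
have FP k x : vle (F x) (P k x) by move=> i; rewrite mxE le_max lexx.
have hP k : regular_map U (P k).
  move=> i; under eq_fun do rewrite mxE.
  by apply: regular_max; [exact: hF|exact/regular_shift/regular_vtop].
have sP k : Rmax_stable (P k).
  move=> x hx i j; have [->|x0] := eqVneq x (mp_zero n).
    rewrite mxE /maxe; case: ifP => _; last by apply: sF => ? ?; rewrite mxE.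
    rewrite -ltey (@le_lt_trans _ _ -oo)//.
    rewrite [vtop _](_ : _ = -oo)//; apply/eqP; rewrite -leeNy_eq.
    by apply: vtop_le => ?; rewrite mxE.
  rewrite mxE -(fineK (vtop_fin hx x0)) /maxe; case: ifP => // _; exact: sF.
have /choice[sy hsy] k : exists sy : R * 'cV[\bar R]_n,
    [/\ vtop sy.2 = 0, P k sy.2 = mp_scale sy.1%:E sy.2 &
      forall lam, subeigenvalue (P k) lam -> (lam <= sy.1)%R].
  have [|s [y h]] :=
    @eigenvector_of_bounded_below (P k) (- k%:R)%R n0 (hP k) (sP k).
    by move=> x i; rewrite mxE le_max lexx orbT.
  by exists (s, y).
pose s k := (sy k).1; pose y := vlim U (fun k => (sy k).2).
have s_ub k lam : subeigenvalue F lam -> (lam <= s k)%R.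
  move=> [x [hx x0 le_x]]; have [_ _] := hsy k; apply.
  by exists x; split=> //; exact: vle_trans le_x (FP k x).
(* [P k] is below [P N] on the normalised eigenvector of [P k], which is thus a subeigenvector of
   [P N]. *)
have s_homo N k : (N <= k)%N -> (s k <= s N)%R.
  move=> Nk; have [_ _] := hsy N; apply; exists (sy k).2.
  have [y0 <- _] := hsy k; split; [exact: vtop0_Rmax|exact: vtop0_neq_zero|].
  move=> i; rewrite !mxE ge_max !le_max lexx /= y0 !adde0 lee_fin.
  by rewrite lerN2 ler_nat Nk orbT.
pose l := ereal_inf (range (fun k => (s k)%:E)).
have l_le k : l <= (s k)%:E by apply: ereal_inf_lbound; exists k.
have y0 : vtop y = 0.
  rewrite (rf_lim (regular_vtop (U := U))).
  under eq_fun => k do (have [-> _ _] := hsy k).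
  by rewrite ulim_cst.
have l_sub lam : subeigenvalue F lam -> lam%:E <= l.
  by move=> h; apply: le_ereal_inf_tmp => _ [k _ <-]; rewrite lee_fin s_ub.
exists l => //; split; last first.
  case=> [r||] [r_fin [x [hx x0 Fx]]] //; last by rewrite leNye.
  by apply: l_sub; exists x; split=> //; rewrite Fx; exact: vle_refl.
split; first by rewrite -ltey (le_lt_trans (l_le 0%N))// ltry.
exists y; split; [exact: vtop0_Rmax|exact: vtop0_neq_zero|].
apply/colP => i.
(* For normalised eigenvectors the perturbation is just [- k], which tends to -oo and drops out of
   the maximum. *)
have FyE : F y i ord0 = ulim U (fun k => (s k)%:E + (sy k).2 i ord0).
  have -> : (fun k => (s k)%:E + (sy k).2 i ord0) =
      (fun k => maxe (F (sy k).2 i ord0) (- k%:R)%:E).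
    apply/funext => k; have [k0 /colP /(_ i) + _] := hsy k.
    by rewrite !mxE k0 adde0 => <-.
  by rewrite ulim_max -(rf_lim (hF i)) ulim_oppr_nat maxeNy.
rewrite FyE mxE; apply: le_anti; apply/andP; split.
  have := l_le 0%N; case El: l => [r||]// _; last by rewrite addNye leNye.
  rewrite mxE -ulim_shift; apply: ulim_homo; apply: filterE => k.
  by rewrite /mkset leeD2r// -El.
(* For a finite entry, [s k <= s N] for [k >= N] gives the bound with each [s N], and then with
   their infimum; for an entry -oo, [s 0] suffices. *)
case Ey: (y i ord0) => [r||].
- rewrite -leeBlDr//; apply: le_ereal_inf_tmp => _ [N _ <-].
  rewrite leeBlDr// -Ey mxE -ulim_shift; apply: ulim_homo.
  by apply: filterS (U_infty N) => k /= Nk; rewrite leeD2r// lee_fin s_homo.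
- by have := le_vtop y i; rewrite y0 Ey.
- rewrite addeNy -(addeNy (s 0%N)%:E) -Ey mxE -ulim_shift; apply: ulim_homo.
  by apply: filterE => k; rewrite /mkset leeD2r// lee_fin s_homo.
Qed.

Lemma spectral_radius_fin F r : is_spectral_radius F r%:E -> subeigenvalue F r.
Proof.
move=> [[_ [x [hx x0 Fx]]] _]; exists x; split=> //.
by rewrite Fx; exact: vle_refl.
Qed.
End SubEigenvalues.

(** * Equal subeigenvalues give equal spectral radii *)

Section SpectralRadiusTransfer.
Context {R : realType} (U : set_system nat) {UU : UltraFilter U}.
Context (U_infty : forall N, U [set k | (N <= k)%N]%classic).

(** A finite spectral radius is itself a subeigenvalue, so each of the two radii dominates the
    other. The dimensions may differ, as they do for the projectors. *)
Lemma spectral_radius_transfer n p (F : 'cV[\bar R]_n -> 'cV[\bar R]_n)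
    (G : 'cV[\bar R]_p -> 'cV[\bar R]_p) r :
  (0 < p)%N -> regular_map U G -> Rmax_stable G ->
  (forall lam, subeigenvalue F lam <-> subeigenvalue G lam) ->
  is_spectral_radius F r -> (forall lam, subeigenvalue F lam -> lam%:E <= r) ->
  is_spectral_radius G r.
Proof.
move=> p0 hG sG FG rF r_sub.
have [s sG' s_sub] := spectral_radius_exists U_infty p0 hG sG.
suff -> : r = s by [].
apply: le_anti; apply/andP; split.
  case: r rF {r_sub} => [r||] rF; last by rewrite leNye.
    exact/s_sub/FG/spectral_radius_fin.
  by case: rF => -[].
case: s sG' {s_sub} => [s||] sG'; last by rewrite leNye.
  exact/r_sub/FG/spectral_radius_fin.
by case: sG' => -[].
Qed.

End SpectralRadiusTransfer.

(** * Residuation *)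

Section Residuation.
Context {R : realType}.

(** For [a = -oo] both sides hold: the sum on the left is -oo even at [x = +oo], and the dual sum is
    +oo even at [w = -oo]. *)
Lemma le_adde_residual (a x w : \bar R) :
  a != +oo -> (a + x <= w) = (x <= (- a + w)%dE).
Proof.
case: a => [a||]// _; last by rewrite addNye daddye leNye leey.
by rewrite dual_addeE_def ?fin_num_adde_defr// [in RHS]addeC leeBrDl.
Qed.

Lemma residualP m n (A : 'M[\bar R]_(m, n)) x y : in_Rmax A ->
  vle (mp_mul A x) y <-> vle x (residual A y).
Proof.
move=> hA; split=> h.
  move=> j; rewrite mxE; apply: le_bigmin; first by rewrite leey.
  move=> i _; rewrite -le_adde_residual//; apply: le_trans (h i).
  by rewrite mxE; exact: (@le_bigmax _ (\bar R) _ _ (fun j => A i j + x j _)).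
move=> i; rewrite mxE; apply: bigmax_le; first by rewrite leNye.
move=> j _; rewrite le_adde_residual//; apply: le_trans (h j) _.
by rewrite mxE; exact: (@bigmin_le _ (\bar R) _ _ i).
Qed.

Lemma le_residual_mul m n (A : 'M[\bar R]_(m, n)) x :
  in_Rmax A -> vle x (residual A (mp_mul A x)).
Proof. by move=> hA; apply/residualP => //; exact: vle_refl. Qed.

Lemma projector_le m n (M : 'M[\bar R]_(m, n)) z :
  in_Rmax M -> vle (projector M z) z.
Proof. by move=> hM; apply/residualP => //; exact: vle_refl. Qed.

Lemma Rmax_mul m n (A : 'M[\bar R]_(m, n)) (x : 'cV[\bar R]_n) :
  in_Rmax A -> in_Rmax x -> in_Rmax (mp_mul A x).
Proof.
move=> hA hx i k; rewrite mxE; apply: bigmaxe_neqy => j.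
by case: (A i j) (hA i j) (x j k) (hx j k) => [a||]// _ [b||].
Qed.

(** This keeps residuals of R_max vectors away from +oo and prevents the product from sending a
    nonzero vector to zero. *)
Definition nonzero_columns m n (A : 'M[\bar R]_(m, n)) : Prop :=
  forall j, exists i, A i j != -oo.

Lemma Rmax_residual m n (A : 'M[\bar R]_(m, n)) (y : 'cV[\bar R]_m) :
  nonzero_columns A -> in_Rmax A -> in_Rmax y -> in_Rmax (residual A y).
Proof.
move=> nzA hA hy j k; rewrite mxE -ltey; have [i Aij] := nzA j.
apply: (@le_lt_trans _ _ (- A i j + y i ord0)%dE).
  exact: (@bigmin_le _ (\bar R) _ _ i).
case: (A i j) Aij (hA i j) (y i ord0) (hy i ord0) => [a||]// _ _ [b||]// _.
by rewrite ltry.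
Qed.

Lemma Rmax_projector m n (M : 'M[\bar R]_(m, n)) (z : 'cV[\bar R]_m) :
  nonzero_columns M -> in_Rmax M -> in_Rmax z -> in_Rmax (projector M z).
Proof. by move=> nzM hM hz; apply/Rmax_mul/Rmax_residual. Qed.

Lemma mul_neq_zero m n (A : 'M[\bar R]_(m, n)) (x : 'cV[\bar R]_n) :
  nonzero_columns A -> x != mp_zero n -> mp_mul A x != mp_zero m.
Proof.
move=> nzA; apply: contraNneq => Ax0; apply/eqP/colP => j; rewrite mxE.
have [i Aij] := nzA j; apply/eqP; rewrite -leeNy_eq leNgt; apply: contraNN Aij.
move=> xj; have : A i j + x j ord0 <= -oo.
  have <- : mp_mul A x i ord0 = -oo by rewrite Ax0 mxE.
  by rewrite mxE; exact: (@le_bigmax _ (\bar R) _ _ (fun j => A i j + x j _)).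
by rewrite leeNy_eq adde_eq_ninfty (gt_eqF xj) orbF.
Qed.

Lemma mul_neq_zero_inv m n (A : 'M[\bar R]_(m, n)) (x : 'cV[\bar R]_n) :
  mp_mul A x != mp_zero m -> x != mp_zero n.
Proof.
apply: contra_neq => ->; apply/colP => i; rewrite !mxE.
by apply/eqP; rewrite -leeNy_eq; apply: bigmax_le => // j _; rewrite mxE addeNy.
Qed.

Lemma vle_vmin n (x u v : 'cV[\bar R]_n) :
  vle x (vmin u v) <-> vle x u /\ vle x v.
Proof.
split=> [h|[hu hv] i]; last by rewrite mxE le_min hu hv.
by split=> i; have := h i; rewrite mxE le_min => /andP[].
Qed.

(** Turns identities between residuals into equivalences that the Galois connection [residualP]
    settles. *)
Lemma vle_ext n (u v : 'cV[\bar R]_n) :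
  (forall x, vle x u <-> vle x v) -> u = v.
Proof. by move=> h; apply: vle_anti; apply/h; exact: vle_refl. Qed.

Lemma residual_vmin m n (A : 'M[\bar R]_(m, n)) u v : in_Rmax A ->
  residual A (vmin u v) = vmin (residual A u) (residual A v).
Proof.
move=> hA; apply: vle_ext => x; rewrite vle_vmin -!residualP//.
exact: vle_vmin.
Qed.

Lemma Rmax_col_mx m1 m2 n (A : 'M[\bar R]_(m1, n)) (B : 'M[\bar R]_(m2, n)) :
  in_Rmax A -> in_Rmax B -> in_Rmax (col_mx A B).
Proof. by move=> hA hB i j; rewrite mxE; case: split. Qed.

Lemma vle_col_mx m1 m2 (u u' : 'cV[\bar R]_m1) (v v' : 'cV[\bar R]_m2) :
  vle (col_mx u v) (col_mx u' v') <-> vle u u' /\ vle v v'.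
Proof.
split=> [h|[hu hv] i]; last by rewrite !mxE; case: split.
by split=> i; [have := h (lshift _ i); rewrite !col_mxEu
              |have := h (rshift _ i); rewrite !col_mxEd].
Qed.

Lemma mp_mul_col_mx m1 m2 n (A : 'M[\bar R]_(m1, n)) (B : 'M[\bar R]_(m2, n))
    (x : 'cV[\bar R]_n) :
  mp_mul (col_mx A B) x = col_mx (mp_mul A x) (mp_mul B x).
Proof.
apply/colP => i; rewrite !mxE; case: splitP => k ik; rewrite mxE;
  apply: eq_bigr => j _; congr (_ + _).
  by rewrite (_ : i = lshift m2 k) ?col_mxEu//; exact: val_inj.
by rewrite (_ : i = rshift m1 k) ?col_mxEd//; exact: val_inj.
Qed.

Lemma residual_col_mx m1 m2 n (A : 'M[\bar R]_(m1, n)) (B : 'M[\bar R]_(m2, n))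
    u v : in_Rmax A -> in_Rmax B ->
  residual (col_mx A B) (col_mx u v) = vmin (residual A u) (residual B v).
Proof.
move=> hA hB; apply: vle_ext => x.
rewrite vle_vmin -!residualP//; last exact: Rmax_col_mx.
by rewrite mp_mul_col_mx vle_col_mx.
Qed.

Lemma Rmax_mp_id m : in_Rmax (mp_id m : 'M[\bar R]_m).
Proof. by move=> i j; rewrite mxE; case: ifP. Qed.

Lemma mul_mp_id m (w : 'cV[\bar R]_m) : mp_mul (mp_id m) w = w.
Proof.
apply/colP => i; rewrite mxE; apply: le_anti; apply/andP; split.
  apply: bigmax_le => [|j _]; first by rewrite leNye.
  rewrite mxE; case: eqVneq => [->|_]; first by rewrite add0e.
  by rewrite addNye leNye.
have := @le_bigmax _ (\bar R) _ -oo (fun j => mp_id m i j + w j ord0) i.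
by rewrite mxE eqxx add0e.
Qed.

Lemma residual_mp_id m (w : 'cV[\bar R]_m) : residual (mp_id m) w = w.
Proof.
apply: vle_ext => x; rewrite -residualP ?mul_mp_id//; exact: Rmax_mp_id.
Qed.

(** The column span of this matrix consists of the pairs [(w, w)], and the greatest one below
    [(u, v)] has [w] equal to their minimum. *)
Lemma projector_diag m (u v : 'cV[\bar R]_m) :
  projector (col_mx (mp_id m) (mp_id m)) (col_mx u v) =
  col_mx (vmin u v) (vmin u v).
Proof.
have hI := @Rmax_mp_id m.
by rewrite /projector residual_col_mx// !residual_mp_id mp_mul_col_mx !mul_mp_id.
Qed.

End Residuation.

(** * Chebyshev distance through order inequalities *)

Section Chebyshev.
Context {R : realType} {m : nat}.
Implicit Types u v : 'cV[\bar R]_m.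

Lemma chebyshev_dist_ge0 u v : 0 <= chebyshev_dist u v.
Proof.
rewrite /chebyshev_dist; case: ifP => _; last exact: leey.
by elim/big_ind: _ => // a b a0 b0; rewrite le_max a0.
Qed.

(** The two inequalities force equal supports, since real translations preserve -oo. The sign of [t]
    is stated apart: for empty supports they hold for every [t], yet the distance is 0. *)
Lemma chebyshev_dist_le u v (t : R) : in_Rmax u -> in_Rmax v ->
  chebyshev_dist u v <= t%:E <->
  [/\ (0 <= t)%R, vle (mp_scale (- t)%:E u) v & vle (mp_scale (- t)%:E v) u].
Proof.
move=> hu hv; split=> [h|[t0 huv hvu]].
  have t0 : (0 <= t)%R by rewrite -lee_fin (le_trans (chebyshev_dist_ge0 u v)).
  move: h; rewrite /chebyshev_dist; case: eqP => // /setP suv h.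
  have le_t i : i \in supp v -> `|u i ord0 - v i ord0| <= t%:E.
    move=> vi; apply: le_trans h.
    exact: (@le_bigmax_cond _ (\bar R) _ _ _ _ (fun i => `|u i _ - v i _|)).
  by split=> // i; move: (suv i) (le_t i) (hu i ord0) (hv i ord0);
    rewrite !inE mxE; case: (u i ord0) => [a||]//; case: (v i ord0) => [b||]// _;
    move=> /(_ isT) + _ _; rewrite !lee_fin ler_norml => /andP[? ?]; lra.
rewrite /chebyshev_dist; have -> : supp u = supp v.
  apply/setP => i; rewrite !inE; have := huv i; have := hvu i; rewrite !mxE.
  by case: (u i ord0) => [a||]; case: (v i ord0) => [b||].
rewrite eqxx; apply: bigmax_le => [|i]; first by rewrite lee_fin.
rewrite inE; have := huv i; have := hvu i; rewrite !mxE.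
case: (u i ord0) (hu i ord0) => [a||]//; case: (v i ord0) (hv i ord0) => [b||]//.
rewrite !lee_fin => _ _ h1 h2 _; rewrite ler_norml; apply/andP; split.
  by rewrite lerBrDr.
by rewrite lerBlDr -lerBlDl addrC.
Qed.

End Chebyshev.

(** * Comparison of the five maps *)

Section Comparison.
Context {R : realType} (U : set_system nat) {UU : UltraFilter U}.
Context {m n : nat} (A B : 'M[\bar R]_(m, n)).
Context (hA : in_Rmax A) (hB : in_Rmax B).
Context (nzAB : nonzero_columns (col_mx A B)).

Local Notation C := (col_mx A B).
Local Notation D := (col_mx (mp_id m) (mp_id m)).
Local Notation h :=
  (fun x => vmin (residual A (mp_mul B x)) (residual B (mp_mul A x))).

Let hC : in_Rmax C := Rmax_col_mx hA hB.
Let hD : in_Rmax D := Rmax_col_mx (@Rmax_mp_id R m) (@Rmax_mp_id R m).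

Lemma nonzero_columns_diag : nonzero_columns (D : 'M[\bar R]_(m + m, m)).
Proof. by move=> j; exists (lshift m j); rewrite col_mxEu mxE eqxx. Qed.

Lemma le_cross_residual (lam : R) (x : 'cV[\bar R]_n) :
  vle (mp_scale lam%:E x) (h x) <->
  vle (mp_scale lam%:E (mp_mul A x)) (mp_mul B x) /\
  vle (mp_scale lam%:E (mp_mul B x)) (mp_mul A x).
Proof.
rewrite vle_vmin -!residualP// !(regular_map_scale (U := U))//;
  exact: regular_mul.
Qed.

(** Chaining the two inequalities gives [2 lam + C x <= C x], and the greatest entry of [C x] is
    finite because no column of [C] vanishes. *)
Lemma cross_subeigenvalue_le0 (lam : R) x :
  in_Rmax x -> x != mp_zero n -> vle (mp_scale lam%:E x) (h x) -> (lam <= 0)%R.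
Proof.
move=> hx x0 /le_cross_residual[hAx hBx].
have fin_top := vtop_fin (Rmax_mul hC hx) (mul_neq_zero nzAB x0).
suff : (lam + lam)%:E + vtop (mp_mul C x) <= vtop (mp_mul C x).
  by rewrite -(fineK fin_top) -EFinD lee_fin => ?; lra.
rewrite -(vtop_scale (U := U)); apply: (rf_homo (regular_vtop (U := U))).
rewrite mp_mul_col_mx -mp_scaleA ![mp_scale _ (col_mx _ _)]map_col_mx.
apply/vle_col_mx.
by split; [apply: vle_trans hBx|apply: vle_trans hAx]; exact: vle_scale.
Qed.

(** [P_D C x] is the pair [(w, w)] with [w] the minimum of [A x] and [B x]; residuals preserve
    minima, so [C^#] expands it into the four terms of [g]. *)
Lemma cross_residual_vmin x :
  vmin (residual A (mp_mul A x))
    (vmin (residual B (mp_mul B x)) (h x)) =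
  residual C (projector D (mp_mul C x)).
Proof.
rewrite mp_mul_col_mx projector_diag residual_col_mx// !residual_vmin//.
by apply: vle_ext => y; rewrite !vle_vmin; tauto.
Qed.

(** As [lam <= 0], the terms [x], [A^# A x] and [B^# B x] that [f] and [g] add to [h] put no further
    constraint on a subeigenvector. *)
Lemma le_cross_residual_self lam x :
  in_Rmax x -> x != mp_zero n -> vle (mp_scale lam%:E x) (h x) ->
  vle (mp_scale lam%:E x) x.
Proof.
move=> hx x0 /(cross_subeigenvalue_le0 hx x0) lam0 i.
by rewrite mxE -[leRHS]add0e leeD2r// lee_fin.
Qed.

Lemma subeigenvalue_f lam :
  subeigenvalue h lam <-> subeigenvalue (fun x => vmin x (h x)) lam.
Proof.
split=> -[x [hx x0]].
  move=> le_x; exists x; split=> //; apply/vle_vmin; split=> //.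
  exact: le_cross_residual_self le_x.
by move=> /vle_vmin[_ le_x]; exists x.
Qed.

Lemma subeigenvalue_g lam :
  subeigenvalue h lam <->
  subeigenvalue (fun x => residual C (projector D (mp_mul C x))) lam.
Proof.
split=> -[x [hx x0 le_x]]; exists x; split=> //; move: le_x;
  rewrite -cross_residual_vmin.
  move=> le_x; have le_xx := le_cross_residual_self hx x0 le_x.
  by do !(apply/vle_vmin; split=> //);
    exact: vle_trans le_xx (le_residual_mul _ _).
by move=> /vle_vmin[_ /vle_vmin[]].
Qed.

(** Subeigenvectors are carried over by [C] in one direction and by [C^# P_D] in the other. *)
Lemma subeigenvalue_projCD lam :
  subeigenvalue h lam <->
  subeigenvalue (fun z => projector C (projector D z)) lam.
Proof.
rewrite subeigenvalue_g; split=> -[x [hx x0 le_x]].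
  exists (mp_mul C x); split; [exact: Rmax_mul|exact: mul_neq_zero|].
  rewrite -(regular_map_scale (regular_mul (U := U) hC)).
  exact: (regular_map_homo (regular_mul (U := U) hC)).
exists (residual C (projector D x)); split.
- apply: Rmax_residual => //; apply: Rmax_projector => //.
  exact: nonzero_columns_diag.
(* Applying [C] to this vector gives [P_C P_D x], which dominates the nonzero vector [lam + x]. *)
- exact/(mul_neq_zero_inv (A := C))/(neq_zero_vle le_x)/scale_neq_zero.
- rewrite -(regular_map_scale (regular_residual (U := U) hC)).
  rewrite -(regular_map_scale (regular_projector (U := U) hD)).
  apply: (regular_map_homo (regular_residual (U := U) hC)).
  exact: (regular_map_homo (regular_projector (U := U) hD)).
Qed.

(** Here the two directions are given by [P_D C] and [C^#]. *)
Lemma subeigenvalue_projDC lam :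
  subeigenvalue h lam <->
  subeigenvalue (fun z => projector D (projector C z)) lam.
Proof.
have sC := regular_map_homo (regular_mul (U := U) hC).
have sC' := regular_map_homo (regular_residual (U := U) hC).
have sD := regular_map_homo (regular_projector (U := U) hD).
rewrite subeigenvalue_g; split=> -[x [hx x0 le_x]].
  exists (projector D (mp_mul C x)); split.
  - exact/(Rmax_projector nonzero_columns_diag hD)/Rmax_mul.
  (* By residuation, [P_D C x] dominates [C (lam + x)], which is nonzero. *)
  - apply: neq_zero_vle (mul_neq_zero nzAB (scale_neq_zero lam x0)).
    exact/residualP.
  - rewrite -(regular_map_scale (regular_projector (U := U) hD)).
    rewrite -(regular_map_scale (regular_mul (U := U) hC)).
    exact/sD/sC.
exists (residual C x); split.
- exact: Rmax_residual.
(* [C C^# x = P_C x] dominates [P_D P_C x], hence [lam + x]. *)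
- apply: (mul_neq_zero_inv (A := C)); apply: neq_zero_vle (scale_neq_zero lam x0).
  exact: vle_trans le_x (projector_le _ _).
- rewrite -(regular_map_scale (regular_residual (U := U) hC)).
  exact: sC'.
Qed.

End Comparison.

(** * The common spectral radius and the minimal distance *)

Theorem theorem4 (R : realType) (m n : nat) (hm : (0 < m)%N) (hn : (0 < n)%N)
  (A B : 'M[\bar R]_(m, n)) (hA : in_Rmax A) (hB : in_Rmax B)
  (hAB : forall j : 'I_n,
     ~ ((forall i, A i j = -oo) /\ (forall i, B i j = -oo))) :
  let C : 'M[\bar R]_(m + m, n) := col_mx A B in
  let D : 'M[\bar R]_(m + m, m) := col_mx (mp_id m) (mp_id m) in
  let f (x : 'cV[\bar R]_n) :=
    vmin x (vmin (residual A (mp_mul B x)) (residual B (mp_mul A x))) in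
  let g (x : 'cV[\bar R]_n) :=
    vmin (residual A (mp_mul A x))
      (vmin (residual B (mp_mul B x))
         (vmin (residual A (mp_mul B x)) (residual B (mp_mul A x)))) in
  let h (x : 'cV[\bar R]_n) :=
    vmin (residual A (mp_mul B x)) (residual B (mp_mul A x)) in
  exists r : \bar R,
    is_spectral_radius (fun z => projector C (projector D z)) r /\
    is_spectral_radius (fun z => projector D (projector C z)) r /\
    is_spectral_radius f r /\
    is_spectral_radius g r /\
    is_spectral_radius h r /\
    exists d : \bar R,
      is_min (fun t => exists x : 'cV[\bar R]_n,
        [/\ in_Rmax x, x != mp_zero n &
            t = chebyshev_dist (mp_mul A x) (mp_mul B x)]) d /\
      r = - d.
Proof.
move=> C D f g h.
(* Any ultrafilter containing all final segments of nat will do. *)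
have [U [UU subU]] :=
  ultraFilterLemma (F := filter_from setT (fun N => [set k | (N <= k)%N]%classic)) _.
have U_infty N : U [set k | (N <= k)%N]%classic by apply: subU; exists N.
have hC : in_Rmax C := Rmax_col_mx hA hB.
have hD : in_Rmax D := Rmax_col_mx (@Rmax_mp_id R m) (@Rmax_mp_id R m).
have nzC : nonzero_columns C.
  move=> j; apply: contrapT => nz; apply: (hAB j); split=> i; apply: contrapT.
    by move=> /eqP Aij; apply: nz; exists (lshift m i); rewrite col_mxEu.
  by move=> /eqP Bij; apply: nz; exists (rshift m i); rewrite col_mxEd.
have nzD : nonzero_columns D := @nonzero_columns_diag R m.
have gE : g = fun x => residual C (projector D (mp_mul C x)).
  by apply/funext => x; exact: cross_residual_vmin.
have regA : regular_map U (fun x : 'cV_n => mp_mul A x).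
  exact: regular_mul.
have regB : regular_map U (fun x : 'cV_n => mp_mul B x).
  exact: regular_mul.
have regC : regular_map U (fun x : 'cV_n => mp_mul C x).
  exact: regular_mul.
have resA : regular_map U (residual A).
  exact: regular_residual.
have resB : regular_map U (residual B).
  exact: regular_residual.
have resC : regular_map U (residual C).
  exact: regular_residual.
have projC : regular_map U (projector C).
  exact: regular_projector.
have projD : regular_map U (projector D).
  exact: regular_projector.
have regh : regular_map U h.
  exact: regular_vmin (regular_comp regB resA) (regular_comp regA resB).
have stabh : Rmax_stable h.
  (* [h x] is the residual of [C] at the stacked vector [(B x, A x)], hence has no entry +oo. *)
  move=> x hx; have := Rmax_residual nzC hC
    (Rmax_col_mx (Rmax_mul hB hx) (Rmax_mul hA hx)).
  by rewrite residual_col_mx.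
have [r rh r_sub] := spectral_radius_exists U_infty hn regh stabh.
exists r.
split; first apply: (spectral_radius_transfer U_infty _ _ _ _ rh) => //.
- by rewrite addn_gt0 hm.
- exact: regular_comp projD projC.
- by move=> z hz; do 2 apply: Rmax_projector => //.
- exact: (subeigenvalue_projCD (U := U)).
split; first apply: (spectral_radius_transfer U_infty _ _ _ _ rh) => //.
- by rewrite addn_gt0 hm.
- exact: regular_comp projC projD.
- by move=> z hz; do 2 apply: Rmax_projector => //.
- exact: (subeigenvalue_projDC (U := U)).
split; first apply: (spectral_radius_transfer U_infty _ _ _ _ rh) => //.
- by apply: regular_vmin regh; exact: regular_id.
- by move=> x hx; apply: Rmax_vle hx => i; rewrite mxE ge_min lexx.
- exact: (subeigenvalue_f (U := U)).
split; first apply: (spectral_radius_transfer U_infty _ _ _ _ rh) => //.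
- rewrite gE; apply: regular_comp resC.
  exact: regular_comp regC projD.
- rewrite gE => x hx; apply: Rmax_residual => //; apply: Rmax_projector => //.
  exact: Rmax_mul.
- by rewrite gE; exact: (subeigenvalue_g (U := U)).
split=> //; exists (- r); split; last by rewrite oppeK.
have dist_sub x lam : in_Rmax x -> x != mp_zero n ->
    chebyshev_dist (mp_mul A x) (mp_mul B x) <= (- lam)%:E <->
    vle (mp_scale lam%:E x) (h x).
  move=> hx x0; rewrite chebyshev_dist_le ?opprK; try exact: Rmax_mul.
  rewrite (le_cross_residual (U := U))//; split=> [[]//|[? ?]]; split=> //.
  rewrite oppr_ge0; apply: (cross_subeigenvalue_le0 (U := U) hA hB nzC hx x0).
  exact/(le_cross_residual (U := U)).
have dist_ge x : in_Rmax x -> x != mp_zero n ->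
    - r <= chebyshev_dist (mp_mul A x) (mp_mul B x).
  move=> hx x0; have := chebyshev_dist_ge0 (mp_mul A x) (mp_mul B x).
  case Ed: chebyshev_dist => [t||]// _; last by rewrite leey.
  (* A finite distance [t] makes [- t] a subeigenvalue of [h]. *)
  rewrite leeNl; apply: r_sub; exists x; split=> //.
  by apply/dist_sub => //; rewrite opprK Ed.
split; last by move=> t [x [hx x0 ->]]; exact: dist_ge.
case: r rh {r_sub} dist_ge => [r||] rh dist_ge.
(* For real [r], an eigenvector of [h] attains the minimum. *)
- have [x [hx x0 le_x]] := spectral_radius_fin rh; exists x; split=> //.
  by apply: le_anti; rewrite dist_ge//=; apply/dist_sub.
- by case: rh => -[].
(* For [r = -oo] every distance is +oo, so any nonzero vector is a minimiser; the constant vector 0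
   is taken. *)
- have e0 : vtop (const_mx 0 : 'cV[\bar R]_n) = 0.
    apply: le_anti; rewrite vtop_le => [|i]; last by rewrite mxE.
    by have := le_vtop (const_mx 0 : 'cV[\bar R]_n) (Ordinal hn); rewrite mxE.
  exists (const_mx 0); split; [exact: vtop0_Rmax|exact: vtop0_neq_zero|].
  apply/esym/eqP; rewrite -leye_eq; apply: dist_ge.
    exact: vtop0_Rmax.
  exact: vtop0_neq_zero.
Qed.
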